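(* Let $L$ be a planar lattice (finite, with a fixed planar diagram) that is generated by its set of atoms. If $L$ has exactly $n$ atoms, then both the left boundary and the right boundary of $L$ have at most $n+1$ elements.
   Context: A planar lattice is a finite lattice together with a fixed planar (Hasse) diagram. For incomparable elements $x,y$, write $x\,\lambda\,y$ (''$x$ is to the left of $y$'') if in the diagram $x$ lies to the left of some (equivalently, every) maximal chain through $y$. Combinatorially, $\lambda$ is a strict partial order on $L$ such that any two distinct elements are comparable with respect to exactly one of $\leq$ and $\lambda$; conversely, every such strict partial order on a finite lattice arises from a planar diagram of it. The left boundary of $L$ is the maximal chain bounding the diagram on the left, that is, the set of all $x\in L$ such that no $y\in L$ satisfies $y\,\lambda\,x$; the right boundary is the set of all $x \in L$ such that no $y\in L$ satisfies $x\,\lambda\,y$. ''Generated by its set of atoms'' means that the smallest subset of $L$ containing all atoms and closed under binary joins and meets is $L$ itself. *)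

(* Defs.v *)
From HB Require Import structures.
From mathcomp Require Import all_boot all_order.
Set Implicit Arguments.
Unset Strict Implicit.
Unset Printing Implicit Defensive.
Import Order.TTheory.
Local Open Scope order_scope.

(* A planar diagram of a finite lattice is represented by its left-of relation
   [lam] (read [lam x y] as: x is to the left of y). These relations are exactly
   the strict partial orders such that two distinct elements are comparable for
   exactly one of <= and [lam]. *)
Record planar_diagram (disp : Order.disp_t) (L : finTBLatticeType disp)
    (lam : rel L) : Prop := PlanarDiagram {
  lam_irr : irreflexive lam;
  lam_trans : transitive lam;
  lam_xor_le : forall x y : L, x != y -> (x >=< y) (+) (lam x y || lam y x)
}.

Definition left_boundary (disp : Order.disp_t) (L : finTBLatticeType disp)
    (lam : rel L) : {set L} := [set x | [forall y, ~~ lam y x]].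

Definition right_boundary (disp : Order.disp_t) (L : finTBLatticeType disp)
    (lam : rel L) : {set L} := [set x | [forall y, ~~ lam x y]].

Definition atoms (disp : Order.disp_t) (L : finTBLatticeType disp) : {set L} :=
  [set a | (\bot < a) && [forall x : L, ~~ (\bot < x < a)]].

(* Only the binary operations are required: neither \bot nor \top has to belong
   to S, and S may be empty. *)
Definition sublattice_closed (disp : Order.disp_t) (L : finTBLatticeType disp)
    (S : {set L}) : bool :=
  [forall x in S, forall y in S, (x `&` y \in S) && (x `|` y \in S)].

Definition sublattice_generated (disp : Order.disp_t)
    (L : finTBLatticeType disp) (A : {set L}) : {set L} :=
  \bigcap_(S : {set L} | (A \subset S) && sublattice_closed S) S.

(* Main.v *)
Require Import Defs.
From HB Require Import structures.
From mathcomp Require Import all_boot all_order.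
Set Implicit Arguments.
Unset Strict Implicit.
Unset Printing Implicit Defensive.
Import Order.TTheory.

(** On the left boundary, which is a chain, send [c] to the number of atoms below
    it, a number between 0 and [n]. This map is injective: given [c] on the
    boundary, the elements that are below [c] or above some atom not below [c]
    form a sublattice containing all atoms, hence all of [L], so every [d > c]
    lies above an atom not below [c]. For closure under meets, suppose that [x]
    and [y] lie above atoms [b] and [b'] not below [c], and above a common atom
    [a <= c]. As [c] is on the boundary, [b] and [b'] are to the right of [a];
    the leftmost of them is between [a] and the other one, so by planarity it is
    below both [x] and [y]. The right boundary is the left boundary of the
    mirrored diagram. *)

Lemma planar_diagram_mirror (disp : Order.disp_t) (L : finTBLatticeType disp)
    (lam : rel L) :
  planar_diagram lam -> planar_diagram (fun x y => lam y x).
Proof.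
case=> irr tr xr; split=> [x|y x z yx zy|x y xy]; first exact: irr.
- exact: tr zy yx.
- by rewrite orbC; apply: xr.
Qed.

Lemma lam_incomparable (disp : Order.disp_t) (L : finTBLatticeType disp)
    (lam : rel L) (x y : L) :
  planar_diagram lam -> lam x y -> ~~ (x >=< y)%O.
Proof.
move=> pd xy; have neq : x != y.
  by apply: contraTneq xy => ->; rewrite (lam_irr pd).
by have := lam_xor_le pd neq; rewrite xy; case: (x >=< y)%O.
Qed.

Lemma incomparable_lam (disp : Order.disp_t) (L : finTBLatticeType disp)
    (lam : rel L) (x y : L) :
  planar_diagram lam -> ~~ (x >=< y)%O -> lam x y || lam y x.
Proof.
move=> pd xy; have neq : x != y.
  by apply: contraNneq xy => ->; apply: comparablexx.
by have := lam_xor_le pd neq; rewrite (negbTE xy).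
Qed.

(** If [x] is not above [b], it is not below [b] either, since [a <= x]. So [x] lies to one side of
    [b], and transitivity puts [a] left of [x] or [x] left of [c], although both are below [x]. *)
Lemma le_between (disp : Order.disp_t) (L : finTBLatticeType disp)
    (lam : rel L) (a b c x : L) :
  planar_diagram lam -> lam a b -> lam b c -> (a <= x)%O -> (c <= x)%O ->
  (b <= x)%O.
Proof.
move=> pd ab bc ax cx; apply/negPn/negP => bx.
have xb : ~~ (x <= b)%O.
  apply/negP => xb; have := lam_incomparable pd ab.
  by rewrite /Order.comparable (le_trans ax xb).
have : ~~ (b >=< x)%O by rewrite /Order.comparable negb_or bx xb.
case/(incomparable_lam pd)/orP => h.
- have := lam_incomparable pd (lam_trans pd ab h).
  by rewrite /Order.comparable ax.
- have := lam_incomparable pd (lam_trans pd h bc).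
  by rewrite /Order.comparable cx orbT.
Qed.

Lemma atom_le (disp : Order.disp_t) (L : finTBLatticeType disp) (a x : L) :
  a \in atoms L -> (x <= a)%O -> x = \bot%O \/ x = a.
Proof.
rewrite inE => /andP[_ /forallP/(_ x)]; rewrite lt0x le_eqVlt => h.
case/orP=> [/eqP|xa]; first by right.
by left; apply/eqP; move: h; rewrite xa andbT negbK.
Qed.

Lemma exists_atom_le (disp : Order.disp_t) (L : finTBLatticeType disp) (x : L) :
  x != \bot%O -> exists2 a, a \in atoms L & (a <= x)%O.
Proof.
(* Induction on the number of elements strictly below [x]. *)
have [m] := ubnP #|[set y : L | (y < x)%O]|.
elim: m x => // m IHm x lt_m x0.
have [xat | ] := boolP (x \in atoms L); first by exists x.
rewrite inE lt0x x0 /= negb_forall => /existsP[y]; rewrite negbK.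
case/andP=> y0 yx; have [||a aat ay] := IHm y; last 1 first.
- by exists a => //; apply: le_trans ay (ltW yx).
- apply: leq_trans (_ : _ <= #|[set y : L | (y < x)%O]|) _; last by [].
  apply: proper_card; apply/properP; split.
    by apply/subsetP=> z; rewrite !inE => zy; apply: lt_trans zy yx.
  by exists y; rewrite inE ?ltxx.
- by rewrite -lt0x.
Qed.

Lemma atoms_lam (disp : Order.disp_t) (L : finTBLatticeType disp)
    (lam : rel L) (a b : L) :
  planar_diagram lam -> a \in atoms L -> b \in atoms L -> a != b ->
  lam a b || lam b a.
Proof.
move=> pd aA bA neq; apply: incomparable_lam => //.
have pos z : z \in atoms L -> z <> \bot%O.
  by rewrite inE lt0x => /andP[/eqP].
apply/negP=> /orP[/(atom_le bA)|/(atom_le aA)] [].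
- exact: pos.
- exact/eqP.
- exact: pos.
- by move/esym; exact/eqP.
Qed.

(** If [b] were left of [a], then [b] and [c] would be incomparable; [c] left of [b] gives [c] left
    of [a], against [a <= c], and [b] left of [c] contradicts the choice of [c]. *)
Lemma left_boundary_atom_lam (disp : Order.disp_t)
    (L : finTBLatticeType disp) (lam : rel L) (c a b : L) :
  planar_diagram lam -> c \in left_boundary lam ->
  a \in atoms L -> b \in atoms L -> (a <= c)%O -> ~~ (b <= c)%O -> lam a b.
Proof.
move=> pd cB aA bA ac bc.
have neq : a != b by apply: contraNneq bc => <-.
case/orP: (atoms_lam pd aA bA neq) => // ba.
have : ~~ (c >=< b)%O.
  rewrite /Order.comparable negb_or bc andbT; apply/negP => cb.
  by have := lam_incomparable pd ba; rewrite /Order.comparable (le_trans ac cb) orbT.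
case/(incomparable_lam pd)/orP => h.
- have := lam_incomparable pd (lam_trans pd h ba).
  by rewrite /Order.comparable ac orbT.
- by move: cB; rewrite inE => /forallP/(_ b); rewrite h.
Qed.

Lemma left_boundary_atom_separates (disp : Order.disp_t)
    (L : finTBLatticeType disp) (lam : rel L) (c x : L) :
  planar_diagram lam -> sublattice_generated (atoms L) = [set: L] ->
  c \in left_boundary lam -> ~~ (x <= c)%O ->
  exists2 a, a \in atoms L & (a <= x)%O && ~~ (a <= c)%O.
Proof.
move=> pd gen cB xc.
pose P y := [exists a in atoms L, (a <= y)%O && ~~ (a <= c)%O].
pose S := [set y : L | (y <= c)%O || P y].
suff: x \in S by rewrite inE (negbTE xc) => /existsP[a /andP[aA h]]; exists a.
have : x \in sublattice_generated (atoms L) by rewrite gen inE.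
move/bigcapP; apply; apply/andP; split.
  apply/subsetP=> a aA; rewrite inE; have [//|ac] := boolP (a <= c)%O.
  by apply/existsP; exists a; rewrite aA lexx ac.
have Ple y z : (y <= z)%O -> P y -> P z.
  move=> yz /existsP[a /and3P[aA ay ac]]; apply/existsP; exists a.
  by rewrite aA ac (le_trans ay yz).
apply/forallP=> y; apply/implyP=> yS; apply/forallP=> z; apply/implyP=> zS.
move: yS zS; rewrite !inE => yS zS; apply/andP; split; last first.
  case/orP: yS => [yc|Py]; last by rewrite (Ple _ _ (leUl y z) Py) orbT.
  case/orP: zS => [zc|Pz]; last by rewrite (Ple _ _ (leUr z y) Pz) orbT.
  by rewrite leUx yc zc.
case/orP: yS => [yc|/existsP[b /and3P[bA yb bc]]].
  by rewrite (le_trans (leIl y z) yc).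
case/orP: zS => [zc|/existsP[b' /and3P[b'A zb' b'c]]].
  by rewrite (le_trans (leIr z y) zc).
(* A zero meet is below [c]. Otherwise some atom [a] lies below both [y] and [z], and planarity is
   used only when [a <= c]. *)
have [->|m0] := eqVneq (y `&` z)%O \bot%O; first by rewrite le0x.
have [a aA] := exists_atom_le m0; rewrite lexI => /andP[ay az].
apply/orP; right; have [ac|ac] := boolP (a <= c)%O; last first.
  by apply/existsP; exists a; rewrite aA ac lexI ay az.
have ab := left_boundary_atom_lam pd cB aA bA ac bc.
have ab' := left_boundary_atom_lam pd cB aA b'A ac b'c.
have [eb|neq] := eqVneq b b'.
  by apply/existsP; exists b; rewrite bA bc lexI yb eb zb'.
(* If [b] is left of [b'], it lies between [a] and [b'], which are both below [z]; hence [b <= z].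
   The other case exchanges [y] and [z]. *)
case/orP: (atoms_lam pd bA b'A neq) => h; apply/existsP.
- by exists b; rewrite bA bc lexI yb (le_between pd ab h az zb').
- by exists b'; rewrite b'A b'c lexI zb' (le_between pd ab' h ay yb).
Qed.

Lemma card_left_boundary (disp : Order.disp_t) (L : finTBLatticeType disp)
    (lam : rel L) :
  planar_diagram lam -> sublattice_generated (atoms L) = [set: L] ->
  #|left_boundary lam| <= #|atoms L|.+1.
Proof.
move=> pd gen; pose A (c : L) := [set a in atoms L | (a <= c)%O].
have Alt c d : c \in left_boundary lam -> (c < d)%O -> #|A c| < #|A d|.
  move=> cB cd; apply: proper_card; apply/properP; split.
    apply/subsetP=> a; rewrite !inE => /andP[-> ac].
    exact: le_trans ac (ltW cd).
  have dc : ~~ (d <= c)%O by rewrite lt_geF.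
  have [a aA /andP[ad ac]] := left_boundary_atom_separates pd gen cB dc.
  by exists a; rewrite inE aA //=.
have Abound c : #|A c| < #|atoms L|.+1.
  by rewrite ltnS subset_leq_card //; apply/subsetP=> a; rewrite inE => /andP[].
(* The count can be 0, so there are [#|atoms L|.+1] possible values. *)
pose f c := Ordinal (Abound c).
rewrite -[leqRHS]card_ord -(card_in_imset (f := f)) ?max_card // => c d cB dB.
move/(congr1 val) => /= eqA; apply/eqP/negPn/negP => neq.
have : (c >=< d)%O.
  apply/negPn/negP => /(incomparable_lam pd)/orP[] h.
  - by move: dB; rewrite inE => /forallP/(_ c); rewrite h.
  - by move: cB; rewrite inE => /forallP/(_ d); rewrite h.
rewrite /Order.comparable !le_eqVlt (negbTE neq) eq_sym (negbTE neq) /=.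
by case/orP=> [/(Alt _ _ cB)|/(Alt _ _ dB)]; rewrite eqA ltnn.
Qed.

Theorem theorem1 (disp : Order.disp_t) (L : finTBLatticeType disp)
    (lam : rel L) (n : nat) :
  planar_diagram lam ->
  sublattice_generated (atoms L) = [set: L] ->
  #|atoms L| = n ->
  #|left_boundary lam| <= n.+1 /\ #|right_boundary lam| <= n.+1.
Proof.
move=> pd gen <-; split; first exact: card_left_boundary.
(* The left boundary for the reversed relation is convertible to [right_boundary lam]. *)
exact: card_left_boundary (planar_diagram_mirror pd) gen.
Qed.
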